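(* Let $\alpha,\beta\in\mathcal{L}$ and let $P:\mathcal{L}\to[0,1]$ be any $\mathbf{mb}^\bigstar$-probability function. If $P(\alpha)$, $P(\neg\alpha)$, $P((\alpha\lor\neg\alpha)\land\bigstar\alpha)$ and $P(\beta)$ are all non-zero, then $$P(\alpha\mid\beta)=\frac{P(\beta\mid\alpha)\cdot P(\alpha)}{P(\beta\mid\alpha)\cdot P(\alpha)+P(\beta\mid\neg\alpha)\cdot P(\neg\alpha)+P(\beta\mid\bigstar\alpha)\cdot P(\bigstar\alpha)-K},$$ where $K=P\big(\beta\mid((\alpha\lor\neg\alpha)\land\bigstar\alpha)\big)\cdot P\big((\alpha\lor\neg\alpha)\land\bigstar\alpha\big)$.
   Context: Let $V$ be a denumerable set of propositional variables and let $\mathcal{L}$ be the set of formulas generated freely from $V$ by the binary connectives $\land,\lor,\longrightarrow$ and the unary connectives $\neg,\bigstar$. The logic $\mathbf{mb}^\bigstar=\langle\mathcal{L},\vdash\rangle$ is given by the Hilbert-style system with the following axiom schemas (for all $\alpha,\beta,\gamma\in\mathcal{L}$): (1) $\alpha\longrightarrow(\beta\longrightarrow\alpha)$; (2) $(\alpha\longrightarrow\beta)\longrightarrow((\alpha\longrightarrow(\beta\longrightarrow\gamma))\longrightarrow(\alpha\longrightarrow\gamma))$; (3) $\alpha\longrightarrow(\beta\longrightarrow(\alpha\land\beta))$; (4) $(\alpha\land\beta)\longrightarrow\alpha$; (5) $(\alpha\land\beta)\longrightarrow\beta$; (6) $\alpha\longrightarrow(\alpha\lor\beta)$; (7) $\beta\longrightarrow(\alpha\lor\beta)$;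 (8) $(\alpha\longrightarrow\gamma)\longrightarrow((\beta\longrightarrow\gamma)\longrightarrow((\alpha\lor\beta)\longrightarrow\gamma))$; (9) $\alpha\lor(\alpha\longrightarrow\beta)$; (10) $\alpha\longrightarrow(\neg\alpha\longrightarrow\beta)$; (11) $(\alpha\lor\neg\alpha)\lor\bigstar\alpha$; and the single inference rule modus ponens (from $\alpha$ and $\alpha\longrightarrow\beta$ infer $\beta$). For $\Gamma\cup\{\varphi\}\subseteq\mathcal{L}$, $\Gamma\vdash\varphi$ means there is a finite sequence of formulas ending in $\varphi$, each of which is an axiom instance, an element of $\Gamma$, or obtained from two earlier members by modus ponens. We write $\vdash\varphi$ for $\emptyset\vdash\varphi$ and $\psi\vdash\varphi$ for $\{\psi\}\vdash\varphi$. An $\mathbf{mb}^\bigstar$-probability function is a function $P:\mathcal{L}\to[0,1]$ such that for all $\varphi,\psi\in\mathcal{L}$: (i) if $\vdash\varphi$ then $P(\varphi)=1$; (ii) if $\varphi\vdash\chi$ for all $\chi\in\mathcal{L}$, then $P(\varphi)=0$; (iii) if $\psi\vdash\varphi$ then $P(\psi)\le P(\varphi)$; (iv) $P(\varphi\lor\psi)=P(\varphi)+P(\psi)-P(\varphi\land\psi)$. The conditional probability is $P(\varphi\mid\psi)=\dfrac{P(\varphi\land\psi)}{P(\psi)}$, defined when $P(\psi)\neq0$. *)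

(* Defs.v *)
From Stdlib Require Import Reals List Ensembles FinFun.
Import ListNotations.

Set Implicit Arguments.

Definition denumerable (V : Type) : Prop :=
  exists f : V -> nat, Bijective f.

Inductive formula (V : Type) : Type :=
  | Var (p : V)
  | And (a b : formula V)
  | Or (a b : formula V)
  | Imp (a b : formula V)
  | Neg (a : formula V)
  | Star (a : formula V).

Declare Scope formula_scope.
Delimit Scope formula_scope with form.
Bind Scope formula_scope with formula.

Notation "¬ a" := (Neg a) (at level 75, right associativity) : formula_scope.
Notation "★ a" := (Star a) (at level 75, right associativity) : formula_scope.
Notation "a ∧ b" := (And a b) (at level 80, right associativity) : formula_scope.
Notation "a ∨ b" := (Or a b) (at level 85, right associativity) : formula_scope.
Notation "a ⟶ b" := (Imp a b) (at level 90, right associativity) : formula_scope.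

Inductive mb_axiom (V : Type) : formula V -> Prop :=
  | Ax1 a b : mb_axiom (a ⟶ (b ⟶ a))
  | Ax2 a b c : mb_axiom ((a ⟶ b) ⟶ ((a ⟶ (b ⟶ c)) ⟶ (a ⟶ c)))
  | Ax3 a b : mb_axiom (a ⟶ (b ⟶ (a ∧ b)))
  | Ax4 a b : mb_axiom ((a ∧ b) ⟶ a)
  | Ax5 a b : mb_axiom ((a ∧ b) ⟶ b)
  | Ax6 a b : mb_axiom (a ⟶ (a ∨ b))
  | Ax7 a b : mb_axiom (b ⟶ (a ∨ b))
  | Ax8 a b c : mb_axiom ((a ⟶ c) ⟶ ((b ⟶ c) ⟶ ((a ∨ b) ⟶ c)))
  | Ax9 a b : mb_axiom (a ∨ (a ⟶ b))
  | Ax10 a b : mb_axiom (a ⟶ ((¬ a) ⟶ b))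
  | Ax11 a : mb_axiom ((a ∨ (¬ a)) ∨ (★ a)).

Definition derivation (V : Type) (Γ : Ensemble (formula V))
    (s : list (formula V)) : Prop :=
  forall i a, nth_error s i = Some a ->
    mb_axiom a \/ In _ Γ a \/
    exists j k b, (j < i)%nat /\ (k < i)%nat /\
      nth_error s j = Some b /\ nth_error s k = Some (b ⟶ a)%form.

Definition entails (V : Type) (Γ : Ensemble (formula V)) (a : formula V) : Prop :=
  exists s, derivation Γ (s ++ [a]).

Notation "Γ ⊢ a" := (entails Γ a%form) (at level 95, no associativity).

Open Scope R_scope.

Record mb_probability (V : Type) (P : formula V -> R) : Prop := {
  prob_range : forall a, 0 <= P a <= 1;
  prob_theorem : forall a, Empty_set _ ⊢ a -> P a = 1;
  prob_bottom : forall a, (forall c, Singleton _ a ⊢ c) -> P a = 0;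
  prob_mono : forall a b, Singleton _ b ⊢ a -> P b <= P a;
  prob_or : forall a b, P (a ∨ b)%form = P a + P b - P (a ∧ b)%form
}.

(* Meaningful only when [P b <> 0]; otherwise the value is that of
   Stdlib's total division by zero. *)
Definition cond_prob (V : Type) (P : formula V -> R) (a b : formula V) : R :=
  P (a ∧ b)%form / P b.

(* Main.v *)
(** Distribution of conjunction over disjunction and axiom (11) make [b]
    interderivable with [((b ∧ a) ∨ (b ∧ ¬a)) ∨ (b ∧ ★a)].  Inclusion-exclusion
    then gives [P b]: the term [(b ∧ a) ∧ (b ∧ ¬a)] is explosive by axiom (10) and
    has probability [0], while the remaining overlap is interderivable with
    [b ∧ ((a ∨ ¬a) ∧ ★a)] and yields [K]. *)

Require Import Defs.
From Stdlib Require Import Reals List Ensembles Lra Lia.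
Import ListNotations.
Open Scope R_scope.

Set Implicit Arguments.

(** Each justification in [t] refers only to earlier members of [t], so shifting its indices by
    [length s] keeps it valid. *)
Lemma derivation_app (V : Type) (Γ : Ensemble (formula V)) s t :
  derivation Γ s -> derivation Γ t -> derivation Γ (s ++ t).
Proof.
  intros Hs Ht i a Hi.
  destruct (Nat.lt_ge_cases i (length s)) as [Hl | Hl].
  - rewrite nth_error_app1 in Hi by assumption.
    destruct (Hs i a Hi) as [H | [H | (j & k & b & Hj & Hk & Ej & Ek)]]; auto.
    right; right; exists j, k, b.
    rewrite !nth_error_app1 by lia; auto.
  - rewrite nth_error_app2 in Hi by assumption.
    destruct (Ht _ a Hi) as [H | [H | (j & k & b & Hj & Hk & Ej & Ek)]]; auto.
    right; right; exists (length s + j)%nat, (length s + k)%nat, b.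
    rewrite !nth_error_app2 by lia.
    replace (length s + j - length s)%nat with j by lia.
    replace (length s + k - length s)%nat with k by lia.
    repeat split; auto; lia.
Qed.

Lemma entails_immediate (V : Type) (Γ : Ensemble (formula V)) a :
  mb_axiom a \/ In _ Γ a -> Γ ⊢ a.
Proof.
  intros H; exists nil; intros [| [| i]] c Hc; simpl in Hc; try discriminate.
  injection Hc as <-; tauto.
Qed.

(** The two derivations are concatenated and [b] is appended, justified by modus ponens from their
    last members. *)
Lemma entails_mp (V : Type) (Γ : Ensemble (formula V)) a b :
  Γ ⊢ a -> Γ ⊢ a ⟶ b -> Γ ⊢ b.
Proof.
  intros [s Hs] [t Ht].
  set (u := (s ++ [a]) ++ (t ++ [(a ⟶ b)%form])).
  assert (Hu : derivation Γ u) by (apply derivation_app; assumption).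
  exists u; intros i c Hi.
  destruct (Nat.lt_ge_cases i (length u)) as [Hl | Hl].
  - rewrite nth_error_app1 in Hi by assumption.
    destruct (Hu i c Hi) as [H | [H | (j & k & d & Hj & Hk & Ej & Ek)]]; auto.
    right; right; exists j, k, d.
    rewrite !nth_error_app1 by lia; auto.
  - rewrite nth_error_app2 in Hi by assumption.
    destruct (i - length u)%nat as [| n] eqn:En; simpl in Hi;
      [injection Hi as <- | destruct n; discriminate].
    assert (Lu : length u = (length s + 1 + (length t + 1))%nat).
    { unfold u; rewrite !length_app; reflexivity. }
    (* These are the positions in [u] of [a], which ends the first derivation, and of [a ⟶ b], which
       ends the second. *)
    right; right; exists (length s), (length s + 1 + length t)%nat, a.
    rewrite !nth_error_app1 by lia.
    repeat split; try lia; unfold u.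
    + rewrite nth_error_app1 by (rewrite length_app; simpl; lia).
      rewrite nth_error_app2, Nat.sub_diag by lia; reflexivity.
    + rewrite nth_error_app2; rewrite length_app; simpl; [| lia].
      rewrite nth_error_app2 by lia.
      replace (length s + 1 + length t - (length s + 1) - length t)%nat
        with 0%nat by lia.
      reflexivity.
Qed.

(** Tree-shaped derivability from a list of hypotheses: it allows structural induction, and
    discharging a hypothesis removes the head of the list. *)
Inductive proves (V : Type) (H : list (formula V)) : formula V -> Prop :=
  | proves_ax a : mb_axiom a -> proves H a
  | proves_hyp a : List.In a H -> proves H a
  | proves_mp a b : proves H a -> proves H (a ⟶ b)%form -> proves H b.

Lemma proves_entails (V : Type) (a b : formula V) :
  proves [a] b -> Singleton _ a ⊢ b.
Proof.
  induction 1 as [c Hc | c Hc | c d _ IHc _ IHd].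
  - apply entails_immediate; auto.
  - apply entails_immediate; right; destruct Hc as [<- | []]; constructor.
  - exact (entails_mp IHc IHd).
Qed.

(** Induction on the derivation: axiom (1) prefixes [a] to axioms and remaining hypotheses, and
    axiom (2) carries the prefix through modus ponens. *)
Lemma deduction (V : Type) (H : list (formula V)) a b :
  proves (a :: H) b -> proves H (a ⟶ b)%form.
Proof.
  assert (Weak : forall c, proves H c -> proves H (a ⟶ c)%form).
  { intros c Hc; eapply proves_mp; [exact Hc |].
    apply proves_ax; constructor. }
  induction 1 as [c Hc | c Hc | c d _ IHc _ IHd].
  - apply Weak, proves_ax, Hc.
  - destruct Hc as [<- | Hc].
    + (* [a ⟶ a] from (2) with [a ⟶ (a ⟶ a)] and [a ⟶ ((a ⟶ a) ⟶ a)]. *)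
      eapply proves_mp; [apply proves_ax, (Ax1 a (a ⟶ a)) |].
      eapply proves_mp; [apply proves_ax, (Ax1 a a) |].
      apply proves_ax; constructor.
    + apply Weak, proves_hyp, Hc.
  - eapply proves_mp; [exact IHd |].
    eapply proves_mp; [exact IHc |].
    apply proves_ax; constructor.
Qed.

Section Rules.
Variables (V : Type) (H : list (formula V)).
Implicit Types a b c : formula V.

Lemma proves_and_intro a b : proves H a -> proves H b -> proves H (a ∧ b)%form.
Proof.
  intros Ha Hb; eapply proves_mp; [exact Hb |].
  eapply proves_mp; [exact Ha |]; apply proves_ax; constructor.
Qed.

Lemma proves_and_left a b : proves H (a ∧ b)%form -> proves H a.
Proof. intros Hab; eapply proves_mp; [exact Hab | apply proves_ax; constructor]. Qed.

Lemma proves_and_right a b : proves H (a ∧ b)%form -> proves H b.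
Proof. intros Hab; eapply proves_mp; [exact Hab | apply proves_ax; constructor]. Qed.

Lemma proves_or_left a b : proves H a -> proves H (a ∨ b)%form.
Proof. intros Ha; eapply proves_mp; [exact Ha | apply proves_ax; constructor]. Qed.

Lemma proves_or_right a b : proves H b -> proves H (a ∨ b)%form.
Proof. intros Hb; eapply proves_mp; [exact Hb | apply proves_ax; constructor]. Qed.

(** Both cases are discharged by the deduction theorem and combined by axiom (8). *)
Lemma proves_or_elim a b c :
  proves H (a ∨ b)%form -> proves (a :: H) c -> proves (b :: H) c -> proves H c.
Proof.
  intros Hab Ha%deduction Hb%deduction.
  eapply proves_mp; [exact Hab |].
  eapply proves_mp; [exact Hb |].
  eapply proves_mp; [exact Ha |]; apply proves_ax; constructor.
Qed.

Lemma proves_explosion a b : proves H a -> proves H (¬ a)%form -> proves H b.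
Proof.
  intros Ha Hna; eapply proves_mp; [exact Hna |].
  eapply proves_mp; [exact Ha |]; apply proves_ax; constructor.
Qed.

End Rules.

Ltac hyp := apply proves_hyp; simpl; tauto.

Section Probability.
Variables (V : Type) (P : formula V -> R) (hP : mb_probability P).

Lemma prob_le (a b : formula V) : proves [a] b -> P a <= P b.
Proof. intros H; apply (prob_mono hP), proves_entails, H. Qed.

Lemma prob_equiv (a b : formula V) : proves [a] b -> proves [b] a -> P a = P b.
Proof. intros Hab Hba; apply Rle_antisym; apply prob_le; assumption. Qed.

Lemma prob_and_comm (a b : formula V) : P (a ∧ b)%form = P (b ∧ a)%form.
Proof.
  apply prob_equiv; apply proves_and_intro;
    (eapply proves_and_right; hyp) || (eapply proves_and_left; hyp).
Qed.

Lemma prob_contradiction (a b : formula V) :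
  P ((b ∧ a) ∧ (b ∧ ¬ a))%form = 0.
Proof.
  apply (prob_bottom hP); intros c; apply proves_entails.
  apply (proves_explosion _ (a := a)).
  - eapply proves_and_right, proves_and_left; hyp.
  - eapply proves_and_right, proves_and_right; hyp.
Qed.

Lemma prob_cases (a b : formula V) :
  P b = P (((b ∧ a) ∨ (b ∧ ¬ a)) ∨ (b ∧ ★ a))%form.
Proof.
  apply prob_equiv.
  - eapply proves_or_elim; [apply proves_ax, (Ax11 a) | |].
    + apply proves_or_left.
      eapply proves_or_elim; [hyp | |].
      * apply proves_or_left, proves_and_intro; hyp.
      * apply proves_or_right, proves_and_intro; hyp.
    + apply proves_or_right, proves_and_intro; hyp.
  - eapply proves_or_elim; [hyp | |].
    + eapply proves_or_elim; [hyp | |]; eapply proves_and_left; hyp.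
    + eapply proves_and_left; hyp.
Qed.

(** Only the rules for [∧] and [∨] are involved, so [c] and [d] stay arbitrary; they become [¬ a]
    and [★ a] in [total_probability]. *)
Lemma prob_overlap (a b c d : formula V) :
  P (((b ∧ a) ∨ (b ∧ c)) ∧ (b ∧ d))%form = P (b ∧ ((a ∨ c) ∧ d))%form.
Proof.
  apply prob_equiv.
  - apply proves_and_intro;
      [eapply proves_and_left, proves_and_right; hyp |].
    apply proves_and_intro;
      [| eapply proves_and_right, proves_and_right; hyp].
    eapply proves_or_elim; [eapply proves_and_left; hyp | |].
    + eapply proves_or_left, proves_and_right; hyp.
    + eapply proves_or_right, proves_and_right; hyp.
  (* The context is quantified because [b] is extracted both at top level and under the hypotheses
     of the case split. *)
  - assert (Hb : forall H, List.In (b ∧ ((a ∨ c) ∧ d))%form H -> proves H b).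
    { intros H HH; eapply proves_and_left, proves_hyp, HH. }
    apply proves_and_intro; [| apply proves_and_intro].
    + eapply proves_or_elim; [eapply proves_and_left, proves_and_right; hyp | |].
      * apply proves_or_left, proves_and_intro; [apply Hb; simpl; tauto | hyp].
      * apply proves_or_right, proves_and_intro; [apply Hb; simpl; tauto | hyp].
    + apply Hb; simpl; tauto.
    + eapply proves_and_right, proves_and_right; hyp.
Qed.

Lemma total_probability (a b : formula V) :
  P b = P (b ∧ a)%form + P (b ∧ ¬ a)%form + P (b ∧ ★ a)%form
        - P (b ∧ ((a ∨ ¬ a) ∧ ★ a))%form.
Proof.
  rewrite (prob_cases a b) at 1.
  (* Inclusion-exclusion applies twice, to the outer disjunction and to the inner
     [(b ∧ a) ∨ (b ∧ ¬ a)]. *)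
  rewrite !(prob_or hP), prob_contradiction, prob_overlap; ring.
Qed.

Lemma cond_prob_mul (a b : formula V) :
  P b <> 0 -> cond_prob P a b * P b = P (a ∧ b)%form.
Proof. intros Hb; unfold cond_prob; field; exact Hb. Qed.

End Probability.

Theorem theorem3p9 (V : Type) (hV : denumerable V) (a b : formula V)
    (P : formula V -> R) (hP : mb_probability P)
    (ha : P a <> 0) (hna : P (¬ a)%form <> 0)
    (hs : P ((a ∨ ¬ a) ∧ ★ a)%form <> 0) (hb : P b <> 0) :
  let K := cond_prob P b ((a ∨ ¬ a) ∧ ★ a) * P ((a ∨ ¬ a) ∧ ★ a)%form in
  cond_prob P a b =
    (cond_prob P b a * P a) /
    (cond_prob P b a * P a + cond_prob P b (¬ a) * P (¬ a)%form
     + cond_prob P b (★ a) * P (★ a)%form - K).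
Proof.
  intros K; unfold K.
  (* By monotonicity [P (★ a)] is at least [P ((a ∨ ¬ a) ∧ ★ a)], which is positive, so conditioning
     on [★ a] is meaningful. *)
  assert (hst : P (★ a)%form <> 0).
  { assert (Hle : P ((a ∨ ¬ a) ∧ ★ a)%form <= P (★ a)%form).
    { apply (prob_le hP); eapply proves_and_right; hyp. }
    pose proof (prob_range hP ((a ∨ ¬ a) ∧ ★ a)%form); lra. }
  rewrite !cond_prob_mul by assumption.
  (* With all products turned into probabilities of conjunctions, the denominator is the expansion
     of [P b]. *)
  rewrite <- (total_probability hP).
  unfold cond_prob; rewrite (prob_and_comm hP); reflexivity.
Qed.
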